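(* Let $(X,d)$ be a finite metric space, and let $n \geqslant 3$ be an integer such that $|X| \leqslant \binom{n}{2}$. Then there exists a real number $\alpha > 0$ such that the rescaled metric space $(X,\alpha \cdot d)$ admits an isometric embedding into $\mathcal{S}([n])$.
   Context: Let $[n] = \{1,\dots,n\}$. The metric space $\mathcal{S}([n])$ is the set of all metrics on $[n]$ modulo proportionality ($\rho \sim \rho'$ if $\rho' = c\rho$ for some real $c>0$), with metric $$d_{\mathcal{S}([n])}([\rho],[\rho']) = \log \max_{j \neq k} \frac{\rho'(j,k)}{\rho(j,k)} - \log \min_{j \neq k} \frac{\rho'(j,k)}{\rho(j,k)}.$$ *)

(* Defs.v *)
From HB Require Import structures.
From mathcomp Require Import all_boot all_order all_algebra generic_quotient.
From mathcomp Require Import all_classical all_reals all_analysis.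

Set Implicit Arguments.
Unset Strict Implicit.
Unset Printing Implicit Defensive.

Import Order.TTheory GRing.Theory Num.Theory.

Local Open Scope ring_scope.
Local Open Scope quotient_scope.

#[short(type="finMetricType")]
HB.structure Definition FinMetric (K : numDomainType) :=
  { M of Finite M & Metric K M }.

Record metric_on (R : realType) (T : finType) := MetricOn {
  metric_fun :> T -> T -> R ;
  metric_fun_xx : forall x, metric_fun x x = 0 ;
  metric_fun_eq0 : forall x y, metric_fun x y = 0 -> x = y ;
  metric_fun_sym : forall x y, metric_fun x y = metric_fun y x ;
  metric_fun_triangle : forall y x z,
    metric_fun x z <= metric_fun x y + metric_fun y z }.

HB.instance Definition _ (R : realType) (T : finType) :=
  gen_eqMixin (metric_on R T).
HB.instance Definition _ (R : realType) (T : finType) :=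
  gen_choiceMixin (metric_on R T).

Section MetricsModuloScaling.
Variables (R : realType) (T : finType).
Implicit Types (r s t : metric_on R T) (x y z : T).

Lemma metric_fun_ge0 r x y : 0 <= r x y.
Proof.
have := metric_fun_triangle r y x x.
by rewrite metric_fun_xx (metric_fun_sym r y x) -mulr2n pmulrn_lge0.
Qed.

Lemma metric_fun_gt0 r x y : x != y -> 0 < r x y.
Proof.
move=> xy; rewrite lt_def metric_fun_ge0 andbT.
by apply: contra xy => /eqP/metric_fun_eq0/eqP.
Qed.

Definition proportional r s : bool :=
  `[< exists2 c : R, 0 < c & forall x y, s x y = c * r x y >].

Lemma proportional_refl : reflexive proportional.
Proof. by move=> r; apply/asboolP; exists 1 => // x y; rewrite mul1r. Qed.

Lemma proportional_sym : symmetric proportional.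
Proof.
suff H r s : proportional r s -> proportional s r.
  by move=> r s; apply/idP/idP; exact: H.
move=> /asboolP[c c0 rs]; apply/asboolP; exists c^-1; first by rewrite invr_gt0.
by move=> x y; rewrite rs mulKf ?gt_eqF.
Qed.

Lemma proportional_trans : transitive proportional.
Proof.
move=> s r t /asboolP[c c0 rs] /asboolP[e e0 st]; apply/asboolP.
by exists (e * c) => [|x y]; rewrite ?mulr_gt0// st rs mulrA.
Qed.

Canonical proportional_equiv :=
  EquivRel proportional proportional_refl proportional_sym proportional_trans.

(* The space S(T); its metric structure is given at the end of this section. *)
Definition metrics_mod : Type := {eq_quot proportional}.

HB.instance Definition _ := Choice.on metrics_mod.
HB.instance Definition _ := Quotient.on metrics_mod.
HB.instance Definition _ := EqQuotient.on metrics_mod.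

(* The ratios are positive, so the default value 0 never affects the maximum,
   and the default value [max_ratio r s] never affects the minimum. *)
Definition max_ratio r s : R :=
  \big[Num.max/0]_(p : T * T | p.1 != p.2) (s p.1 p.2 / r p.1 p.2).

Definition min_ratio r s : R :=
  \big[Num.min/max_ratio r s]_(p : T * T | p.1 != p.2) (s p.1 p.2 / r p.1 p.2).

Definition log_ratio_dist r s : R := ln (max_ratio r s) - ln (min_ratio r s).

Lemma ratio_gt0 r s x y : x != y -> 0 < s x y / r x y.
Proof. by move=> xy; rewrite divr_gt0 ?metric_fun_gt0. Qed.

Lemma le_max_ratio r s x y : x != y -> s x y / r x y <= max_ratio r s.
Proof.
move=> xy; exact: (le_bigmax_cond (P := fun p : T * T => p.1 != p.2) 0
  (fun p => s p.1 p.2 / r p.1 p.2) (j := (x, y))).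
Qed.

Lemma min_ratio_le r s x y : x != y -> min_ratio r s <= s x y / r x y.
Proof.
move=> xy; exact: (bigmin_le_cond (P := fun p : T * T => p.1 != p.2)
  (max_ratio r s) (fun p => s p.1 p.2 / r p.1 p.2) (j := (x, y))).
Qed.

Lemma max_ratio_attained r s x y : x != y ->
  exists p : T * T, p.1 != p.2 /\ max_ratio r s = s p.1 p.2 / r p.1 p.2.
Proof.
move=> xy; have m0 := lt_le_trans (ratio_gt0 r s xy) (le_max_ratio r s xy).
have : max_ratio r s = 0 \/
    exists p : T * T, p.1 != p.2 /\ max_ratio r s = s p.1 p.2 / r p.1 p.2.
  rewrite {1 2}/max_ratio; elim/big_rec : _ => [|p v pp IH]; first by left.
  by case: leP => _; [exact: IH|right; exists p].
by case=> // m; rewrite m ltxx in m0.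
Qed.

Lemma min_ratio_attained r s x y : x != y ->
  exists p : T * T, p.1 != p.2 /\ min_ratio r s = s p.1 p.2 / r p.1 p.2.
Proof.
move=> xy; rewrite /min_ratio; elim/big_rec : _ => [|p v pp IH].
  exact: max_ratio_attained xy.
by case: leP => _ //; exists p.
Qed.

Lemma max_ratio_gt0 r s x y : x != y -> 0 < max_ratio r s.
Proof.
by move=> xy; exact: lt_le_trans (ratio_gt0 r s xy) (le_max_ratio r s xy).
Qed.

Lemma min_ratio_gt0 r s x y : x != y -> 0 < min_ratio r s.
Proof. by move=> /(min_ratio_attained r s)[p [pp ->]]; exact: ratio_gt0. Qed.

Lemma trivial_or_pair : (forall x y : T, x = y) \/ (exists x y : T, x != y).
Proof.
case: (pselect (exists x y : T, x != y)) => [|H]; first by right.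
by left=> x y; apply/eqP; apply: contra_notT H => xy; exists x, y.
Qed.

Lemma log_ratio_dist_trivial r s :
  (forall x y : T, x = y) -> log_ratio_dist r s = 0.
Proof.
move=> T1; have nop (p : T * T) : (p.1 != p.2) = false.
  by rewrite (T1 p.1 p.2) eqxx.
by rewrite /log_ratio_dist /min_ratio big_pred0// subrr.
Qed.

Lemma log_ratio_dist_xx r : log_ratio_dist r r = 0.
Proof.
have [/log_ratio_dist_trivial//|[x [y xy]]] := trivial_or_pair.
have [p [pp max1]] := max_ratio_attained r r xy.
have [q [qq min1]] := min_ratio_attained r r xy.
by rewrite /log_ratio_dist max1 min1 !divff ?gt_eqF ?metric_fun_gt0// subrr.
Qed.

Lemma log_ratio_dist_eq0 r s : log_ratio_dist r s = 0 -> proportional r s.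
Proof.
have [T1 _|[x [y xy]] /eqP] := trivial_or_pair.
  by apply/asboolP; exists 1 => // x y; rewrite (T1 x y) !metric_fun_xx mulr0.
rewrite subr_eq0 => /eqP /ln_inj; rewrite !posrE => mm.
have {}mm : max_ratio r s = min_ratio r s.
  by apply: mm; [exact: max_ratio_gt0 xy|exact: min_ratio_gt0 xy].
apply/asboolP; exists (max_ratio r s); first exact: max_ratio_gt0 xy.
move=> a b; have [->|ab] := eqVneq a b; first by rewrite !metric_fun_xx mulr0.
have -> : max_ratio r s = s a b / r a b.
  by apply/eqP; rewrite eq_le le_max_ratio// mm min_ratio_le.
by rewrite divfK// gt_eqF// metric_fun_gt0.
Qed.

Lemma max_ratio_inv r s x y : x != y -> max_ratio s r = (min_ratio r s)^-1.
Proof.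
move=> xy; apply/eqP; rewrite eq_le; apply/andP; split.
  have [p [pp ->]] := max_ratio_attained s r xy.
  rewrite -invf_div lef_pV2 ?posrE ?ratio_gt0//; first exact: min_ratio_le.
  exact: min_ratio_gt0 xy.
by have [p [pp ->]] := min_ratio_attained r s xy; rewrite invf_div le_max_ratio.
Qed.

Lemma log_ratio_distE r s x y : x != y ->
  log_ratio_dist r s = ln (max_ratio r s) + ln (max_ratio s r).
Proof.
move=> xy; rewrite /log_ratio_dist (max_ratio_inv r s xy).
by rewrite lnV ?posrE//; exact: min_ratio_gt0 xy.
Qed.

Lemma log_ratio_dist_sym r s : log_ratio_dist r s = log_ratio_dist s r.
Proof.
have [T1|[x [y xy]]] := trivial_or_pair; first by rewrite !log_ratio_dist_trivial.
by rewrite (log_ratio_distE r s xy) (log_ratio_distE s r xy) addrC.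
Qed.

Lemma max_ratio_mul r s t x y : x != y ->
  max_ratio r t <= max_ratio r s * max_ratio s t.
Proof.
move=> xy; have [[a b] /= [ab ->]] := max_ratio_attained r t xy.
have -> : t a b / r a b = (s a b / r a b) * (t a b / s a b).
  by rewrite [RHS]mulrC mulrA divfK// gt_eqF// metric_fun_gt0.
by rewrite ler_pM ?le_max_ratio// ltW// ratio_gt0.
Qed.

Lemma log_ratio_dist_triangle s r t :
  log_ratio_dist r t <= log_ratio_dist r s + log_ratio_dist s t.
Proof.
have [T1|[x [y xy]]] := trivial_or_pair.
  by rewrite !log_ratio_dist_trivial// addr0.
have lnM' u v w : ln (max_ratio u w) <= ln (max_ratio u v) + ln (max_ratio v w).
  have max0 u' v' : max_ratio u' v' \is Num.pos.
    by rewrite posrE; exact: max_ratio_gt0 xy.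
  rewrite -lnM// ler_ln// ?rpredM//; exact: max_ratio_mul xy.
rewrite !(log_ratio_distE _ _ xy) addrACA lerD// addrC; exact: lnM'.
Qed.

Lemma proportional_dist0 r s : proportional r s -> log_ratio_dist r s = 0.
Proof.
move=> /asboolP[c c0 rs].
have [/log_ratio_dist_trivial//|[x [y xy]]] := trivial_or_pair.
have [p [pp max1]] := max_ratio_attained r s xy.
have [q [qq min1]] := min_ratio_attained r s xy.
by rewrite /log_ratio_dist max1 min1 !rs !mulfK ?gt_eqF ?metric_fun_gt0// subrr.
Qed.

Lemma log_ratio_dist_proportional r r' s s' :
  proportional r r' -> proportional s s' ->
  log_ratio_dist r s = log_ratio_dist r' s'.
Proof.
suff H a a' b b' : proportional a a' -> proportional b b' ->
    log_ratio_dist a b <= log_ratio_dist a' b'.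
  by move=> rr ss; apply/eqP; rewrite eq_le !H// proportional_sym.
move=> /proportional_dist0 aa /proportional_dist0 bb.
rewrite (le_trans (log_ratio_dist_triangle a' _ _))// aa add0r.
rewrite (le_trans (log_ratio_dist_triangle b' _ _))//.
by rewrite (log_ratio_dist_sym b' b) bb addr0.
Qed.

Definition metrics_mod_dist (p q : metrics_mod) : R :=
  log_ratio_dist (repr p) (repr q).

Lemma metrics_mod_dist_pi r s :
  metrics_mod_dist (\pi_(metrics_mod) r) (\pi_(metrics_mod) s) =
  log_ratio_dist r s.
Proof.
by apply: log_ratio_dist_proportional; apply/eqmodP; rewrite reprK.
Qed.

Lemma metrics_mod_dist_xx p : metrics_mod_dist p p = 0.
Proof. exact: log_ratio_dist_xx. Qed.

Lemma metrics_mod_dist_eq0 p q : metrics_mod_dist p q = 0 -> p = q.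
Proof.
by move=> /log_ratio_dist_eq0 pq; rewrite -[p]reprK -[q]reprK; apply/eqmodP.
Qed.

Lemma metrics_mod_dist_sym p q : metrics_mod_dist p q = metrics_mod_dist q p.
Proof. exact: log_ratio_dist_sym. Qed.

Lemma metrics_mod_dist_triangle q p u :
  metrics_mod_dist p u <= metrics_mod_dist p q + metrics_mod_dist q u.
Proof. exact: log_ratio_dist_triangle. Qed.

HB.instance Definition _ := isMetric.Build R metrics_mod
  metrics_mod_dist_xx metrics_mod_dist_eq0 metrics_mod_dist_sym
  metrics_mod_dist_triangle.

Lemma mdist_metrics_mod r s :
  mdist (\pi_(metrics_mod) r) (\pi_(metrics_mod) s) =
  ln (max_ratio r s) - ln (min_ratio r s).
Proof. exact: metrics_mod_dist_pi. Qed.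

End MetricsModuloScaling.

(* Main.v *)
Require Import Defs.
From mathcomp Require Import all_boot all_order all_algebra.
From mathcomp Require Import all_classical all_reals all_analysis.

(** In logarithmic coordinates, a metric on [T] is a vector indexed by the
    pairs of points of [T], scaling translates it by a constant vector, and the
    distance between two classes is the spread (maximum minus minimum) of the
    difference of their vectors.  Every vector with coordinates in [0, ln 2]
    comes from a metric ([log_weight_metric]), because the triangle inequality
    is automatic when all distances lie between 1 and 2.

    It remains to embed [X], up to scale, in a space of vectors with the spread
    as distance.  The Kuratowski map [x |-> (z |-> d x z)] does this: the
    difference [d y z - d x z] lies between [- d x y] and [d x y], and both
    bounds are reached, at [z = y] and [z = x], so that its spread is
    [2 * d x y].  This map takes one coordinate per point of [X]; as there are
    ['C(n, 2)] pairs to hold them, points of [X] can be assigned distinct pairs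
    ([injection_to_pairs]).  The pairs left over get coordinate 0, which adds
    the value 0 to the differences; it lies between the two bounds, so that
    the spread is unchanged. *)

Import Order.TTheory GRing.Theory Num.Theory.

Local Open Scope ring_scope.

Definition log_weight_dist {R : realType} {T : finType} (u : {set T} -> R)
    (x y : T) : R :=
  if x == y then 0 else expR (u [set x; y]).

(** Distances between 1 and 2 satisfy the triangle inequality, as 2 <= 1 + 1. *)
Lemma log_weight_triangle (R : realType) (T : finType) (u : {set T} -> R)
    (hu : forall A, 0 <= u A <= ln 2) (y x z : T) :
  log_weight_dist u x z <= log_weight_dist u x y + log_weight_dist u y z.
Proof.
have exp1 A : 1 <= expR (u A).
  by rewrite -expR0 ler_expR; case/andP: (hu A).
have exp2 A : expR (u A) <= 2.
  by rewrite -[leRHS]lnK ?posrE// ler_expR; case/andP: (hu A).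
rewrite /log_weight_dist; have [->|xy] := eqVneq x y; first by rewrite add0r.
have [<-|yz] := eqVneq y z; first by rewrite addr0 (negbTE xy).
case: eqP => [_|_]; first by rewrite addr_ge0// expR_ge0.
by rewrite (le_trans (exp2 _))// -[leLHS]/(1 + 1) lerD.
Qed.

Definition log_weight_metric {R : realType} {T : finType} {u : {set T} -> R}
    (hu : forall A, 0 <= u A <= ln 2) : metric_on R T.
Proof.
refine (@MetricOn R T (log_weight_dist u) _ _ _
  (log_weight_triangle R T u hu)).
- by move=> x; rewrite /log_weight_dist eqxx.
- move=> x y; rewrite /log_weight_dist; case: eqP => // _ /eqP.
  by rewrite gt_eqF// expR_gt0.
- by move=> x y; rewrite /log_weight_dist eq_sym finset.setUC.
Defined.

Lemma log_weight_ratio (R : realType) (T : finType) (u v : {set T} -> R)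
    (hu : forall A, 0 <= u A <= ln 2) (hv : forall A, 0 <= v A <= ln 2)
    (x y : T) :
  x != y -> log_weight_metric hv x y / log_weight_metric hu x y =
    expR (v [set x; y] - u [set x; y]).
Proof. by move=> /negbTE xy; rewrite /= /log_weight_dist xy expRB. Qed.

(** The logarithm of a ratio of distances is a difference of weights, so the
    distance is the spread of these differences.  It is stated with the two
    pairs at which the extreme values are reached, because the Kuratowski map
    exhibits them. *)
Lemma log_ratio_dist_log_weight (R : realType) (T : finType)
    (u v : {set T} -> R)
    (hu : forall A, 0 <= u A <= ln 2) (hv : forall A, 0 <= v A <= ln 2)
    (A B : {set T}) :
  #|A| = 2%N -> #|B| = 2%N ->
  (forall C, v B - u B <= v C - u C <= v A - u A) ->
  log_ratio_dist (log_weight_metric hu) (log_weight_metric hv) =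
    (v A - u A) - (v B - u B).
Proof.
move=> /eqP/cards2P[a [a' [aa ->]]] /eqP/cards2P[b [b' [bb ->]]] vu.
rewrite /log_ratio_dist; set r := log_weight_metric hu.
set s := log_weight_metric hv.
have -> : max_ratio r s = s a a' / r a a'.
  apply/eqP; rewrite eq_le le_max_ratio// andbT.
  have [p [pp ->]] := max_ratio_attained r s aa.
  by rewrite !log_weight_ratio// ler_expR; case/andP: (vu [set p.1; p.2]).
have -> : min_ratio r s = s b b' / r b b'.
  apply/eqP; rewrite eq_le min_ratio_le//=.
  have [p [pp ->]] := min_ratio_attained r s aa.
  by rewrite !log_weight_ratio// ler_expR; case/andP: (vu [set p.1; p.2]).
by rewrite !log_weight_ratio// !expRK.
Qed.

Lemma injection_to_pairs (X T : finType) :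
  (#|X| <= 'C(#|T|, 2))%N ->
  exists2 c : X -> {set T}, injective c & forall x, #|c x| = 2%N.
Proof.
rewrite -(card_draws T 2) => hX.
exists (fun x => enum_val (widen_ord hX (enum_rank x))).
  move=> x y /enum_val_inj /(congr1 val) /= /ord_inj; exact: enum_rank_inj.
move=> x; have := enum_valP (widen_ord hX (enum_rank x)).
by rewrite inE => /eqP.
Qed.

Section KuratowskiCoordinates.
Context {R : realType} {X : finMetricType R} {I : eqType} (c : X -> I).
Hypothesis c_inj : injective c.

(** For [c] injective the sum has at most one term; writing it as a sum gives
    the value 0 to the indices of no point, and needs no default point, so
    that [X] may be empty. *)
Definition kuratowski (x : X) (i : I) : R := \sum_(z | c z == i) mdist x z.

Lemma kuratowskiE (x z : X) : kuratowski x (c z) = mdist x z.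
Proof.
rewrite /kuratowski (eq_bigl (pred1 z)) ?big_pred1_eq// => w /=.
exact: inj_eq.
Qed.

Lemma kuratowski_out (i : I) :
  (forall z, c z != i) -> forall x, kuratowski x i = 0.
Proof. by move=> ci x; rewrite /kuratowski big_pred0// => z; exact/negbTE. Qed.

Lemma kuratowskiP (i : I) :
  (exists z, i = c z) \/ (forall x, kuratowski x i = 0).
Proof.
case: (boolP [exists z, c z == i]) => [/existsP[z /eqP <-]|/existsPn ci].
  by left; exists z.
by right; exact: kuratowski_out.
Qed.

Lemma kuratowski_ge0 (x : X) (i : I) : 0 <= kuratowski x i.
Proof. by apply: sumr_ge0 => z _; exact: mdist_ge0. Qed.

Lemma kuratowski_le (D : R) (x : X) (i : I) :
  (forall z, mdist x z <= D) -> kuratowski x i <= D.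
Proof.
move=> xD; have [[z ->]|->] := kuratowskiP i; first by rewrite kuratowskiE.
by rewrite (le_trans _ (xD x)) ?mdist_ge0.
Qed.

Lemma kuratowski_lipschitz (x y : X) (i : I) :
  - mdist x y <= kuratowski y i - kuratowski x i <= mdist x y.
Proof.
have [[z ->]|k0] := kuratowskiP i; last first.
  by rewrite !k0 subrr oppr_le0 mdist_ge0.
rewrite !kuratowskiE lerBrDr addrC lerBlDr lerBlDr; apply/andP; split.
  by rewrite addrC metric_triangle.
by rewrite (metric_sym x y) metric_triangle.
Qed.

End KuratowskiCoordinates.

Theorem theorem4p5 (R : realType) (X : finMetricType R) (n : nat)
    (hn : (3 <= n)%N) (hX : (#|X| <= 'C(n, 2))%N) :
  exists2 alpha : R, 0 < alpha &
    exists f : X -> metrics_mod R 'I_n,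
      forall x y : X, mdist (f x) (f y) = alpha * mdist x y.
Proof.
have [c c_inj c2] : exists2 c : X -> {set 'I_n},
    injective c & forall x, #|c x| = 2%N.
  by apply: injection_to_pairs; rewrite card_ord.
(* An upper bound of the diameter, kept positive even if X has no two points. *)
pose D : R := \big[Num.max/1]_(p : X * X) mdist p.1 p.2.
have D_gt0 : 0 < D by rewrite (lt_le_trans ltr01)// bigmax_ge_id.
have dD (x y : X) : mdist x y <= D.
  exact: (le_bigmax 1 (fun p : X * X => mdist p.1 p.2) (x, y)).
(* Scaling by t brings the Kuratowski coordinates into [0, ln 2]. *)
pose t : R := ln 2 / D.
have t_gt0 : 0 < t by rewrite divr_gt0// ln_gt0// ltr1n.
have hu x A : 0 <= t * kuratowski c x A <= ln 2.
  rewrite mulr_ge0 ?kuratowski_ge0 ?(ltW t_gt0)//= -[leRHS](divfK (lt0r_neq0 D_gt0)).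
  by rewrite ler_pM2l// kuratowski_le.
exists (2 * t); first by rewrite mulr_gt0.
exists (fun x => \pi_(metrics_mod R 'I_n)%qT (log_weight_metric (hu x))) => x y.
rewrite mdist_metrics_mod -/(log_ratio_dist _ _).
rewrite (log_ratio_dist_log_weight _ _ _ _ _ _ (c x) (c y))//.
  rewrite -!mulrBr !kuratowskiE// !mdistxx (metric_sym y x) subr0 sub0r opprK.
  by rewrite -mulr2n mulrnAr -mulrA mulr_natl.
move=> A; rewrite -!mulrBr !ler_pM2l// !kuratowskiE// !mdistxx.
by rewrite (metric_sym y x) subr0 sub0r kuratowski_lipschitz.
Qed.
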